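(* Let $K\ge 1$, $K'\ge 0$ and let $f=h+\overline{g}$ be a $(K,K')$-elliptic harmonic mapping defined on the unit disc $\mathbb{D}$, where $h$ and $g$ are analytic in $\mathbb{D}$ with $$h(z)=\sum_{n=1}^{\infty} a_n z^n \quad\text{and}\quad g(z)=\sum_{n=1}^{\infty} b_n z^n .$$ If $\lambda$ is a constant such that $\lambda_f(z)\le \lambda$ for all $z\in\mathbb{D}$, then $$|a_n|+|b_n|\le \frac{K\lambda+\sqrt{K'}}{n}\qquad (n=1,2,\ldots).$$
   Context: $\mathbb{D}=\{z\in\mathbb{C}:|z|<1\}$. A complex-valued function $f=u+iv$ is harmonic if $u$ and $v$ are real-valued harmonic functions. For a continuously differentiable $f$, put $\Lambda_f=|f_z|+|f_{\bar z}|$, $\lambda_f=\big||f_z|-|f_{\bar z}|\big|$, and $J_f=|f_z|^2-|f_{\bar z}|^2$ (the Jacobian). A harmonic function $f$ is sense-preserving if $J_f(z)>0$ in its domain. A function is $ACL$ in a domain $\Omega$ if for every closed rectangle $R\subset\Omega$ with sides parallel to the axes it is absolutely continuous on almost every horizontal and almost every vertical line in $R$; it is $ACL^2$ if moreover its partial derivatives are locally $L^2$ in $\Omega$. A sense-preserving continuous mapping $f:\mathbb{D}\to\mathbb{C}$ is $(K,K')$-elliptic, where $K\ge1$ and $K'\ge0$ are constants, if (1) $f$ is $ACL^2$ in $\mathbb{D}$ and $J_f\ne0$ a.e. in $\mathbb{D}$, and (2) $\|D_f\|^2\le K J_f+K'$ a.e. in $\mathbb{D}$, where $\|D_f\|=\Lambda_f$.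 *)

(* Defs.v *)
From mathcomp Require Import all_boot all_order all_algebra.
From mathcomp Require Import all_classical all_reals all_analysis.
From mathcomp Require Export complex.

Set Implicit Arguments.
Unset Strict Implicit.
Unset Printing Implicit Defensive.

Import Order.TTheory GRing.Theory Num.Theory.
Import numFieldNormedType.Exports.

Local Open Scope classical_set_scope.
Local Open Scope ring_scope.
Local Open Scope complex_scope.

(* The regular module R[i]^o, rather than the bare R[i], carries the norm
   topology in MathComp-Analysis. *)
Notation Cplx R := (R[i]^o).

Section HarmonicEllipticMappings.
Context {R : realType}.
Local Notation C := (Cplx R).
Implicit Types (O : set C) (u : C -> R) (f h : C -> C) (z : C).

(* The modulus as an element of R; `|z| lives in R[i]. *)
Definition modulus z : R := Normc.normc z.

Definition unit_disc : set C := [set z | modulus z < 1].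

Local Notation plane := (measurableTypeR R * measurableTypeR R)%type.
Definition reim (p : plane) : C := p.1 +i* p.2.

Definition du_dx u z : R :=
  derive1 (fun x : R => u (x +i* complex.Im z)) (complex.Re z).
Definition du_dy u z : R :=
  derive1 (fun y : R => u (complex.Re z +i* y)) (complex.Im z).

Definition d_dx f z : C :=
  du_dx (fun w => complex.Re (f w)) z +i* du_dx (fun w => complex.Im (f w)) z.
Definition d_dy f z : C :=
  du_dy (fun w => complex.Re (f w)) z +i* du_dy (fun w => complex.Im (f w)) z.

Definition d_dz f z : C := (d_dx f z - 'i * d_dy f z) / 2%:R.
Definition d_dzbar f z : C := (d_dx f z + 'i * d_dy f z) / 2%:R.

Definition Lambda_ f z : R := modulus (d_dz f z) + modulus (d_dzbar f z).
Definition lambda_ f z : R := `|modulus (d_dz f z) - modulus (d_dzbar f z)|.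
Definition Jacobian f z : R :=
  modulus (d_dz f z) ^+ 2 - modulus (d_dzbar f z) ^+ 2.

Definition C1_on O u : Prop :=
  [/\ forall z, O z -> derivable (fun x : R => u (x +i* complex.Im z))
        (complex.Re z) 1,
      forall z, O z -> derivable (fun y : R => u (complex.Re z +i* y))
        (complex.Im z) 1,
      {within O, continuous (du_dx u)} &
      {within O, continuous (du_dy u)}].

Definition real_harmonic_on O u : Prop :=
  [/\ C1_on O u, C1_on O (du_dx u), C1_on O (du_dy u) &
      forall z, O z -> du_dx (du_dx u) z + du_dy (du_dy u) z = 0].

Definition harmonic_on O f : Prop :=
  real_harmonic_on O (fun z => complex.Re (f z)) /\
  real_harmonic_on O (fun z => complex.Im (f z)).

Definition analytic_on O h : Prop := forall z, O z -> derivable h z 1.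

Definition sense_preserving_on O f : Prop :=
  forall z, O z -> 0 < Jacobian f z.

Definition absolutely_continuous (a b : R) (phi : R -> C) : Prop :=
  forall e : R, 0 < e -> exists2 d : R, 0 < d &
    forall (n : nat) (s t : 'I_n -> R),
      (forall i, a <= s i /\ s i < t i /\ t i <= b) ->
      (forall i j, i != j -> t i <= s j \/ t j <= s i) ->
      \sum_(i < n) (t i - s i) < d ->
      \sum_(i < n) modulus (phi (t i) - phi (s i)) < e.

Definition ACL_on O f : Prop :=
  forall a b c d : R, a < b -> c < d ->
    (forall x y, a <= x <= b -> c <= y <= d -> O (x +i* y)) ->
    {ae (@lebesgue_measure R), forall y : R, c <= y <= d ->
       absolutely_continuous a b (fun x => f (x +i* y))} /\
    {ae (@lebesgue_measure R), forall x : R, a <= x <= b ->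
       absolutely_continuous c d (fun y => f (x +i* y))}.

Local Notation lebesgue2 := (@lebesgue_measure R \x @lebesgue_measure R)%E.

Definition locally_L2_on O f : Prop :=
  [/\ measurable_fun (reim @^-1` O) (fun p => complex.Re (f (reim p))),
      measurable_fun (reim @^-1` O) (fun p => complex.Im (f (reim p))) &
      forall A : set C, A `<=` O -> compact A ->
        (\int[lebesgue2]_(p in reim @^-1` A)
           (modulus (f (reim p)) ^+ 2)%:E < +oo)%E].

(* derive1 is 0 where the derivative does not exist; for an ACL function this
   happens only on a null set, so local square integrability is unaffected. *)
Definition ACL2_on O f : Prop :=
  [/\ ACL_on O f, locally_L2_on O (d_dx f) & locally_L2_on O (d_dy f)].

Definition elliptic_on O (K K' : R) f : Prop :=
  [/\ sense_preserving_on O f /\ {within O, continuous f},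
      ACL2_on O f,
      {ae lebesgue2, forall p, O (reim p) -> Jacobian f (reim p) != 0} &
      {ae lebesgue2, forall p, O (reim p) ->
         Lambda_ f (reim p) ^+ 2 <= K * Jacobian f (reim p) + K'}].

End HarmonicEllipticMappings.

(* Main.v *)
(* Where |f_z| > |f_zbar| one has J_f = Lambda_f lambda_f, so the quadratic
   inequality Lambda_f^2 <= K lam Lambda_f + K' gives
   Lambda_f <= M := K lam + sqrt K'; this holds almost everywhere, hence
   everywhere by continuity of the partial derivatives.  Choose unimodular u, v
   with u a_n = |a_n| and v b_n = |b_n| and put F = u h + v g.  Then
   |F'| <= |h'| + |g'| = Lambda_f <= M.  For 0 < r < 1 the power series
   F(z) - F(rz) has coefficients (u a_k + v b_k)(1 - r^k) and modulus at most
   M r (1 - r) on |z| = r, so Cauchy's estimate there gives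
   (|a_n| + |b_n|)(1 + r + ... + r^(n-1)) r^n <= M r; let r tend to 1. *)
Require Import Defs.
From mathcomp Require Import all_boot all_order all_algebra.
From mathcomp Require Import all_classical all_reals all_analysis.
From mathcomp Require Import cyclic separable cyclotomic.
From mathcomp Require Import zify ring lra.

Set Implicit Arguments.
Unset Strict Implicit.
Unset Printing Implicit Defensive.

Import Order.TTheory GRing.Theory Num.Theory.
Import numFieldNormedType.Exports.

Local Open Scope classical_set_scope.
Local Open Scope ring_scope.
Local Open Scope complex_scope.

(** * The real-valued modulus on the complex numbers *)

Section Modulus.
Context {R : realType}.
Local Notation C := (Cplx R).
Implicit Types z w : C.

Lemma normr_modulus z : `|z| = (modulus z)%:C.
Proof. by case: z. Qed.

Lemma modulus_ge0 z : 0 <= modulus z.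
Proof. by case: z => x y; apply: sqrtr_ge0. Qed.

Lemma modulusM z w : modulus (z * w) = modulus z * modulus w.
Proof. exact: Normc.normcM. Qed.

Lemma modulusD z w : modulus (z + w) <= modulus z + modulus w.
Proof. exact: (@le_normcD R z w). Qed.

Lemma modulusN z : modulus (- z) = modulus z.
Proof. exact: (@normcN R z). Qed.

Lemma modulusB z w : modulus (z - w) = modulus (w - z).
Proof. by rewrite -modulusN opprB. Qed.

Lemma modulus0 : modulus (0 : C) = 0.
Proof. exact: Normc.normc0. Qed.

Lemma modulus1 : modulus (1 : C) = 1.
Proof. exact: Normc.normc1. Qed.

Lemma modulus_eq0 z : modulus z = 0 -> z = 0.
Proof. exact: Normc.eq0_normc. Qed.

Lemma modulusX z n : modulus (z ^+ n) = modulus z ^+ n.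
Proof.
elim: n => [|n IHn]; first by rewrite !expr0 modulus1.
by rewrite !exprS modulusM IHn.
Qed.

Lemma modulus_real (x : R) : modulus (x%:C : C) = `|x|.
Proof. by rewrite /modulus /Normc.normc /= expr0n addr0 sqrtr_sqr. Qed.

Lemma modulus_conjc z : modulus (conjc z : C) = modulus z.
Proof. by case: z => x y; rewrite /modulus /= sqrrN. Qed.

Lemma modulus_sum (I : Type) (s : seq I) (P : pred I) (F : I -> C) :
  modulus (\sum_(i <- s | P i) F i) <= \sum_(i <- s | P i) modulus (F i).
Proof.
elim/big_ind2 : _ => [|x1 x2 y1 y2 le1 le2|//]; first by rewrite modulus0.
by apply: le_trans (modulusD _ _) (lerD le1 le2).
Qed.

Lemma Re_le_modulus z : complex.Re z <= modulus z.
Proof.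
case: z => x y; apply: le_trans (ler_norm x) _.
by rewrite -sqrtr_sqr ler_wsqrtr // lerDl sqr_ge0.
Qed.

Lemma modulus_le_ReDIm z : modulus z <= `|complex.Re z| + `|complex.Im z|.
Proof.
case: z => x y; rewrite {1}(_ : x +i* y = (x%:C : C) + 'i * (y%:C : C)).
  by rewrite (le_trans (modulusD _ _)) // modulusM !modulus_real
     /modulus /= expr0n expr1n add0r sqrtr1 mul1r.
by rewrite {1}[x +i* y]complexE.
Qed.

(** For z nonzero take u = |z| / z. This aligns the arguments of two coefficients, and it turns the
    modulus of an increment into the real part of a rotated increment. *)
Lemma unimodular_rotation z : exists2 u : C, modulus u = 1 & u * z = (modulus z)%:C.
Proof.
have [->|z0] := eqVneq z 0; first by exists 1; rewrite ?modulus1 // mulr0 modulus0.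
have mz0 : modulus z != 0 by apply: contra_neq z0; exact: modulus_eq0.
exists ((modulus z)%:C / z); last by rewrite divfK.
have := modulusM ((modulus z)%:C / z) z.
rewrite divfK // modulus_real ger0_norm ?modulus_ge0 // -[LHS]mul1r.
by move/(mulIf mz0).
Qed.

(** The norm takes values in [R[i]], where a positive epsilon is a complex number with zero
    imaginary part; both directions pass between such an epsilon and its real part. *)
Lemma cvgn_modulusP (s : nat -> C) (l : C) :
  s @ \oo --> l <->
  forall e : R, 0 < e -> exists N, forall n, (N <= n)%N -> modulus (s n - l) < e.
Proof.
split=> [/cvgrPdist_lt sl e e0|sl].
  have [N _ NP] := sl e%:C ltac:(by rewrite ltcR).
  exists N => n Nn; have := NP n Nn.
  by rewrite /= normr_modulus ltcR modulusB.
apply/cvgrPdist_lt => e; rewrite ltcE => /andP[/= /eqP ei er].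
have [N NP] := sl _ er; exists N => // n /= Nn.
by rewrite normr_modulus ltcE /= ei eqxx /= modulusB NP.
Qed.

End Modulus.

(** * Cauchy's coefficient estimate by averaging over roots of unity *)

Section CoefficientBound.
Context {R : realType}.
Local Notation C := (Cplx R).
Implicit Types (c : nat -> C) (r B : R).

(** X^n - 1 splits over an algebraically closed field and is separable in characteristic 0, so it
    has n distinct roots, and one of them is primitive. *)
Lemma prim_root_complex n : (0 < n)%N -> exists w : C, n.-primitive_root w.
Proof.
move=> n_gt0; pose p : {poly R[i]} := 'X^n - 1.
have [s Ep] := closed_field_poly_normal p.
rewrite lead_coefXnsubC // scale1r in Ep.
have p_s: all n.-unity_root s.
  by apply/allP => w ws; change (is_true (root p w)); rewrite Ep root_prod_XsubC.
have s_uniq : uniq s.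
  by rewrite -separable_prod_XsubC -Ep separable_Xn_sub_1 // pnatr_eq0 -lt0n.
have s_size : size s = n.
  by have := congr1 (fun q : {poly _} => size q) Ep;
     rewrite size_XnsubC // size_prod_XsubC => -[].
have := has_prim_root n_gt0 p_s s_uniq; rewrite s_size => /(_ (leqnn n)) /hasP[w _ pw].
by exists w.
Qed.

(** If w^m differs from 1, the geometric sum times w^m - 1 equals w^(mn) - 1 = 0. *)
Lemma sum_expr_prim_root n (w : C) m : n.-primitive_root w ->
  \sum_(j < n) w ^+ (j * m) = (if (n %| m)%N then n%:R else 0).
Proof.
move=> pw; under eq_bigr do rewrite mulnC exprM.
case: ifP; rewrite (prim_order_dvd pw).
  by move/eqP ->; under eq_bigr do rewrite expr1n; rewrite sumr_const card_ord.
move=> wm1; have := subrX1 (w ^+ m) n.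
rewrite -exprM mulnC exprM (prim_expr_order pw) expr1n subrr => /esym/eqP.
by rewrite mulf_eq0 subr_eq0 wm1 => /= /eqP.
Qed.

(* Averaging over the roots of unity of order [N.+1] isolates one coefficient
   of a polynomial of degree at most [N]. *)
Lemma poly_coef_bound c N n r B : 0 <= r -> (1 <= n <= N)%N ->
  (forall z : C, modulus z = r ->
     modulus (\sum_(1 <= k < N.+1) c k * z ^+ k) <= B) ->
  modulus (c n) * r ^+ n <= B.
Proof.
move=> r0 /andP[n1 nN] bB.
have [w pw] := prim_root_complex (ltn0Sn N).
have w1 : modulus w = 1.
  apply/eqP; rewrite -(@pexpr_eq1 _ _ N.+1) ?modulus_ge0 //.
  by rewrite -modulusX (prim_expr_order pw) modulus1.
(* Since w^(N+1) = 1, the weight is w^(-jn) written with a natural exponent. *)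
pose S := \sum_(j < N.+1) w ^+ (j * (N.+1 - n)) *
            \sum_(1 <= k < N.+1) c k * (r%:C * w ^+ j) ^+ k.
have SE : S = N.+1%:R * (c n * r%:C ^+ n).
  rewrite /S; under eq_bigr do rewrite big_distrr /=.
  rewrite exchange_big /= (bigD1_seq n) ?mem_index_iota ?iota_uniq ?n1 ?ltnS //=.
  rewrite [X in _ + X]big1_seq ?addr0.
    rewrite (eq_bigr (fun=> c n * r%:C ^+ n)).
      by rewrite sumr_const card_ord mulr_natl.
    move=> j _; rewrite exprMn -exprM mulrCA; congr (_ * _).
    rewrite mulrCA -exprD -mulnDr subnK 1?ltnW // mulnC exprM.
    by rewrite (prim_expr_order pw) expr1n mulr1.
  move=> k /andP[kn]; rewrite mem_index_iota => /andP[k1 kN].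
  rewrite (eq_bigr (fun j : 'I_N.+1 => c k * r%:C ^+ k * w ^+ (j * (N.+1 - n + k)))).
    rewrite -big_distrr /= sum_expr_prim_root //.
    case: ifP => [|_]; last by rewrite mulr0.
    (* N+1-n+k lies strictly between 0 and 2(N+1), so divisibility by N+1 forces k = n. *)
    move=> /dvdnP[q Eq]; exfalso; move/eqP: kn; apply; clear -Eq n1 nN k1 kN.
    by case: q Eq => [|[|q]] Eq; nia.
  by move=> j _; rewrite exprMn -exprM mulnDr exprD; ring.
have : modulus S <= N.+1%:R * B.
  apply: le_trans (modulus_sum _ _ _) _.
  rewrite mulr_natl -[N.+1 in X in _ <= X](card_ord N.+1) -sumr_const ler_sum // => j _.
  rewrite modulusM modulusX w1 expr1n mul1r bB // modulusM modulusX w1 expr1n.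
  by rewrite modulus_real ger0_norm // mulr1.
rewrite SE !modulusM modulusX modulus_real ger0_norm //.
have -> : modulus (N.+1%:R : C) = N.+1%:R.
  by rewrite (_ : N.+1%:R = (N.+1%:R : R)%:C) ?modulus_real ?rmorph_nat // ger0_norm.
by rewrite ler_pM2l // ltr0n.
Qed.

Lemma sum_geometric_tail (q : R) N L : 0 <= q < 1 -> 
  \sum_(N <= k < L) q ^+ k <= q ^+ N / (1 - q).
Proof.
move=> /andP[q0 q1]; have q1' : 0 < 1 - q by rewrite subr_gt0.
rewrite ler_pdivlMr //.
have [NL|LN] := leqP N L; last by rewrite big_geq ?(ltnW LN) // mul0r exprn_ge0.
rewrite big_distrl /= (@telescope_sumr_eq _ _ _ (fun k => - q ^+ k)) //.
  by rewrite opprK addrC gerBl exprn_ge0.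
by move=> k _; rewrite exprSr; ring.
Qed.

(** The polynomial estimate is applied to partial sums. Convergence at a radius beyond r dominates
    the tails on |z| = r by a geometric series, so the partial sums there exceed B by an arbitrarily
    small amount, uniformly in z. *)
Lemma series_coef_bound c (G : C -> C) r B n : 0 < r < 1 -> (1 <= n)%N ->
  (forall z : C, modulus z < 1 ->
     (fun N : nat => \sum_(1 <= k < N.+1) c k * z ^+ k) @ \oo --> G z) ->
  (forall z : C, modulus z = r -> modulus (G z) <= B) ->
  modulus (c n) * r ^+ n <= B.
Proof.
move=> /andP[r0 r1] n1 cG GB.
pose S N (z : C) := \sum_(1 <= k < N.+1) c k * z ^+ k.
(* The midpoint r' of r and 1 is still inside the disc, and q = r / r' < 1 is the ratio of the
   dominating series. *)
pose r' := (r + 1) / 2; pose q := r / r'.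
have r'0 : 0 < r' by rewrite /r'; lra.
have q01 : 0 <= q < 1.
  rewrite /q divr_ge0 ?ltW //= ltr_pdivrMr // mul1r /r'; lra.
have r'1 : modulus (r'%:C : C) < 1.
  by rewrite modulus_real gtr0_norm // /r'; lra.
have [N0 N0P] := (@cvgn_modulusP R _ _).1 (cG _ r'1)  1 ltr01.
(* Two consecutive partial sums at r' are each within 1 of the limit, so the term |c_k| r'^k is at
   most 2. *)
have cle k : (N0 < k)%N -> modulus (c k) * r ^+ k <= 2 * q ^+ k.
  move=> N0k; have -> : r = q * r' by rewrite divfK // gt_eqF.
  rewrite exprMn [q ^+ k * _]mulrC mulrA ler_wpM2r ?exprn_ge0 ?(andP q01).1 //.
  have := ltrD (N0P k (ltnW N0k)) (N0P k.-1 ltac:(by case: k N0k)).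
  case: k N0k => // k N0k /=.
  rewrite [modulus (\sum_(1 <= _ < k.+1) _ - _)]modulusB => /ltW.
  move=> /(le_trans (modulusD _ _)).
  rewrite addrA subrK big_nat_recr //= addrAC subrr add0r modulusM modulusX.
  by rewrite modulus_real gtr0_norm // [1 + 1]/(2).
have [q0 q1] := andP q01.
have Sle N z : (N0 <= N)%N -> modulus z = r ->
    modulus (S N z) <= B + 2 * (q ^+ N.+1 / (1 - q)).
  move=> N0N zr; apply/ler_addgt0Pr => e e0.
  have z1 : modulus z < 1 by rewrite zr.
  (* L depends on z, but the resulting bound does not: [S N z] is compared with a longer sum close
     to [G z], and their difference is a geometric tail. *)
  have [L LP] := (@cvgn_modulusP R _ _).1 (cG _ z1) e e0.
  have {LP} := LP (maxn L N) (leq_maxl _ _).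
  set M := maxn L N; have NM : (N <= M)%N by apply: leq_maxr.
  move=> SMe; have -> : S N z = - (S M z - S N z) + (S M z - G z) + G z by ring.
  apply: le_trans (modulusD _ _) _; rewrite [leLHS]addrC -addrA lerD ?GB //.
  apply: le_trans (modulusD _ _) _; rewrite lerD //; last exact: ltW.
  rewrite modulusN /S (@big_cat_nat _ _ _ N.+1 1 M.+1) //= [X in X - _]addrC addrK.
  apply: le_trans (modulus_sum _ _ _) _.
  apply: le_trans (_ : \sum_(N.+1 <= k < M.+1) 2 * q ^+ k <= _); last first.
    by rewrite -big_distrr /= ler_pM2l // sum_geometric_tail.
  rewrite big_nat [leRHS]big_nat ler_sum // => k /andP[Nk _].
  by rewrite modulusM modulusX zr cle // (leq_ltn_trans N0N).
apply/ler_addgt0Pr => e e0.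
have : (fun N => q ^+ N) @ \oo --> 0 by apply: cvg_expr; rewrite ger0_norm.
(* Once q^(N+1) is below this threshold, the excess 2 q^(N+1) / (1 - q) is below e. *)
have e'0 : 0 < e * (1 - q) / 2 by rewrite divr_gt0 // mulr_gt0 // subr_gt0.
move=> /cvgrPdist_lt /(_ _ e'0)[N1 _ N1P].
pose N := maxn n (maxn N0 N1).
have [nN N0N N1N] : [/\ (n <= N)%N, (N0 <= N)%N & (N1 <= N)%N].
  by rewrite /N !leq_max !leqnn !orbT.
apply: le_trans (poly_coef_bound (N := N) (B := B + 2 * (q ^+ N.+1 / (1 - q))) _ _ _) _.
- exact: ltW.
- by rewrite n1.
- by move=> z; apply: Sle.
rewrite lerD2l mulrA ler_pdivrMr ?subr_gt0 //.
have := N1P N.+1 (leqW N1N); rewrite /= sub0r normrN ger0_norm ?exprn_ge0 //; lra.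
Qed.

End CoefficientBound.

(** * First-order expansions, Wirtinger derivatives and radial increments *)

Section RealDifferential.
Context {R : realType}.
Local Notation C := (Cplx R).
Implicit Types (f h : C -> C) (L : C -> C) (z w l : C).

(* Real Frechet differentiability of [f] at [z] with differential [L], except
   that linearity of [L] is not imposed; [L = *%R l] is complex
   differentiability with derivative [l]. *)
Definition expands f z L : Prop :=
  forall e : R, 0 < e -> exists2 d : R, 0 < d & forall w, modulus w < d ->
    modulus (f (z + w) - f z - L w) <= e * modulus w.

Lemma derivable_expands h z : derivable h z 1 -> exists l, expands h z ( *%R l).
Proof.
move=> /cvg_ex[l /cvgrPdist_lt hl]; exists l => e e0.
have /nbhs_ballP[d d0 dP] := hl e%:C ltac:(by rewrite ltcR).
move: d0; rewrite /= ltcE => /andP[/= /eqP di d0].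
exists (complex.Re d) => // w wd.
have [->|w0] := eqVneq w 0; first by rewrite addr0 subrr mulr0 subr0 modulus0 mulr0.
have := dP w; rewrite /ball /= sub0r normrN normr_modulus ltcE /= di eqxx.
move=> /(_ wd w0); rewrite normr_modulus ltcR => /ltW le_e.
have -> : h (z + w) - h z - l * w =
    - (l - w^-1 *: (h (w *: 1 + z) - h z)) * w.
  rewrite [_ *: 1]mulr1 [w + z]addrC [w^-1 *: _]mulrC opprB mulrBl.
  by rewrite divfK.
by rewrite modulusM modulusN ler_wpM2r ?modulus_ge0.
Qed.

Lemma expandsD f h z L1 L2 : expands f z L1 -> expands h z L2 ->
  expands (fun w => f w + h w) z (fun w => L1 w + L2 w).
Proof.
move=> fL hL e e0; have e20 : 0 < e / 2 by lra.
have [d1 d10 fd] := fL _ e20; have [d2 d20 hd] := hL _ e20.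
exists (Num.min d1 d2) => [|w]; rewrite ?lt_min ?d10 // => /andP[w1 w2].
have -> : f (z + w) + h (z + w) - (f z + h z) - (L1 w + L2 w) =
  (f (z + w) - f z - L1 w) + (h (z + w) - h z - L2 w) by ring.
by apply: le_trans (modulusD _ _) _; have := fd w w1; have := hd w w2; lra.
Qed.

Lemma expandsZ f z L a : expands f z L ->
  expands (fun w => a * f w) z (fun w => a * L w).
Proof.
move=> fL e e0; have a1 : 0 < modulus a + 1 by rewrite ltr_wpDl ?modulus_ge0.
have [d d0 fd] := fL _ (divr_gt0 e0 a1); exists d => // w /fd fw.
rewrite -!mulrBr modulusM.
apply: le_trans (_ : (modulus a + 1) * (e / (modulus a + 1) * modulus w) <= _).
  apply: ler_pM fw; rewrite ?modulus_ge0 //; lra.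
by rewrite mulrA [_ * (e / _)]mulrC divfK ?gt_eqF.
Qed.

Lemma expands_conjc f z L : expands f z L ->
  expands (fun w => conjc (f w)) z (fun w => conjc (L w)).
Proof.
move=> fL e /fL[d d0 fd]; exists d => // w /fd.
by rewrite -modulus_conjc !rmorphB.
Qed.

(** Differentiability is local and the disc is open: increments shorter than 1 - |z| stay inside it.
    This transfers the expansion of h + conj(g) to f. *)
Lemma expands_disc f h z L : unit_disc z ->
  (forall w, unit_disc w -> f w = h w) -> expands h z L -> expands f z L.
Proof.
move=> z1 fh hL e /hL[d d0 hd]; exists (Num.min d (1 - modulus z)).
  by rewrite lt_min d0 subr_gt0.
move=> w; rewrite lt_min => /andP[wd w1]; rewrite !fh ?hd //.
by apply: le_lt_trans (modulusD _ _) _; lra.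
Qed.

Lemma is_derive_of_expansion (p : R -> R) (t m : R) :
  (forall e : R, 0 < e -> exists2 d : R, 0 < d & forall s, `|s| < d ->
     `|p (t + s) - p t - m * s| <= e * `|s|) -> is_derive t 1 p m.
Proof.
move=> pm.
have pcvg : s^-1 *: ((p \o shift t) (s *: 1) - p t) @[s --> 0^'] --> m.
  apply/cvgrPdist_le => e e0; have [d d0 pd] := pm e e0.
  apply/nbhs_ballP; exists d => //= s; rewrite /ball /= sub0r normrN => sd s0.
  have E (X : R) : m - s^-1 * X = - (s^-1 * (X - m * s)) by field.
  have -> : m - s^-1 *: (p (s *: 1 + t) - p t) =
      - (s^-1 * (p (t + s) - p t - m * s)).
    rewrite [s *: 1]mulr1 [s + t]addrC; exact: E.
  rewrite normrN normrM normfV ler_pdivrMl ?normr_gt0 // [leRHS]mulrC pd //.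
by apply: DeriveDef; [apply: (cvgP m pcvg) | apply: cvg_lim pcvg].
Qed.

(** The chain rule along a real line in direction u. Keeping p separate lets it serve the two
    coordinate directions as well as the radial path. *)
Lemma is_derive_Re_expands f z L u (p : R -> R) (t : R) :
  expands f z L -> (forall s : R, L (s%:C * u) = s%:C * L u) ->
  (forall s : R, p (t + s) = complex.Re (f (z + s%:C * u))) ->
  is_derive t 1 p (complex.Re (L u)).
Proof.
move=> fL Lu pf; apply: is_derive_of_expansion => e e0.
have u1 : 0 < modulus u + 1 by rewrite ltr_wpDl ?modulus_ge0.
have [d d0 fd] := fL _ (divr_gt0 e0 u1).
exists (d / (modulus u + 1)) => [|s]; first by rewrite divr_gt0.
rewrite ltr_pdivlMr // => sd.
have su : modulus (s%:C * u) <= `|s| * (modulus u + 1).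
  by rewrite modulusM modulus_real ler_wpM2l // lerDl.
have := fd _ (le_lt_trans su sd).
set w := _ - L _ => wle; have -> : p (t + s) - p t - complex.Re (L u) * s = complex.Re w.
  rewrite pf -[in p t](addr0 t) pf mul0r addr0 /w Lu !raddfB /=.
  by case: (L u) => x y /=; ring.
have Rew : `|complex.Re w| <= modulus w.
  rewrite ler_norml Re_le_modulus andbT lerNl -raddfN.
  by rewrite -modulusN Re_le_modulus.
apply: le_trans Rew (le_trans wle _).
apply: le_trans (_ : e / (modulus u + 1) * (`|s| * (modulus u + 1)) <= _).
  by rewrite ler_wpM2l // ltW // divr_gt0.
by rewrite mulrCA divfK ?gt_eqF // mulrC.
Qed.

Lemma partials_of_expands f z L : expands f z L ->
  (forall (s : R) u, L (s%:C * u) = s%:C * L u) ->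
  d_dx f z = L 1 /\ d_dy f z = L 'i.
Proof.
move=> fL Lh.
(* Imaginary parts are treated as real parts of -i f. *)
have iL : expands (fun w => - 'i * f w) z (fun w => - 'i * L w) by apply: expandsZ.
have iLh (s : R) u : - 'i * L (s%:C * u) = s%:C * (- 'i * L u).
  by rewrite Lh mulrCA.
have ImE w : complex.Im w = complex.Re (- 'i * w : C).
  by case: w => x y /=; ring.
have zx (s : R) : z + s%:C * 1 = (complex.Re z + s) +i* complex.Im z.
  by case: z {fL iL} => x y; rewrite mulr1; congr (_ +i* _); rewrite addr0.
have zy (s : R) : z + s%:C * 'i = complex.Re z +i* (complex.Im z + s).
  by case: z {fL iL zx} => x y; apply/eqP; rewrite eq_complex /=; apply/andP;
    split; apply/eqP; ring.
split; apply/eqP; rewrite eq_complex /=; apply/andP; split; apply/eqP;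
  rewrite ?ImE; rewrite /du_dx /du_dy derive1E; apply: derive_val.
- by apply: (is_derive_Re_expands fL) => // s; rewrite zx.
- by apply: (is_derive_Re_expands iL) => // s; rewrite zx ImE.
- by apply: (is_derive_Re_expands fL) => // s; rewrite zy.
- by apply: (is_derive_Re_expands iL) => // s; rewrite zy ImE.
Qed.

(** The differential is w -> l w + conj(m w), so f_x = l + conj(m) and f_y = i (l - conj(m)). *)
Lemma harmonic_decomposition_derivatives f h g z l m : unit_disc z ->
  (forall w, unit_disc w -> f w = h w + conjc (g w)) ->
  expands h z ( *%R l) -> expands g z ( *%R m) ->
  d_dz f z = l /\ d_dzbar f z = conjc m.
Proof.
move=> z1 fE hl gm.
have fL : expands f z (fun w => l * w + conjc (m * w)).
  exact: expands_disc z1 fE (expandsD hl (expands_conjc gm)).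
have [|fx fy] := partials_of_expands fL.
  move=> s u; rewrite mulrCA [m * _]mulrCA [in LHS]rmorphM mulrDr /=.
  by congr (_ + _ * _); rewrite /= oppr0.
have two0 : (2%:R : C) != 0 by rewrite pnatr_eq0.
rewrite /d_dz /d_dzbar fx fy; split; apply: (mulIf two0); rewrite divfK //.
  by case: l m {hl gm fL fx fy} => [x y] [x' y']; apply/eqP;
    rewrite eq_complex /=; apply/andP; split; apply/eqP; ring.
by case: l m {hl gm fL fx fy} => [x y] [x' y']; apply/eqP;
  rewrite eq_complex /=; apply/andP; split; apply/eqP; ring.
Qed.

(** The mean value theorem is real, so it is applied to s -> Re(u f(sz)) on [t, 1], with u rotating
    the total increment onto the nonnegative reals. *)
Lemma radial_increment_bound f (f' : C -> C) (M t : R) z :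
  (forall w, unit_disc w -> expands f w ( *%R (f' w))) ->
  (forall w, unit_disc w -> modulus (f' w) <= M) ->
  0 <= t < 1 -> unit_disc z ->
  modulus (f z - f (t%:C * z)) <= M * modulus z * (1 - t).
Proof.
move=> fd f'M /andP[t0 t1] z1.
have [u u1 uE] := unimodular_rotation (f z - f (t%:C * z)).
pose p (s : R) := complex.Re (u * f (s%:C * z)).
have disc s : s \in `[t, 1] -> unit_disc (s%:C * z).
  rewrite in_itv /= => /andP[ts s1]; have s0 : 0 <= s := le_trans t0 ts.
  rewrite /unit_disc /= modulusM modulus_real ger0_norm //.
  by apply: le_lt_trans z1; rewrite ler_piMl ?modulus_ge0.
have dp s : s \in `[t, 1] -> is_derive s 1 p (complex.Re (u * (f' (s%:C * z) * z))).
  move=> /disc sz; apply: (is_derive_Re_expands (expandsZ u (fd _ sz))).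
    by move=> r /=; rewrite (mulrCA (f' _)) (mulrCA u).
  by move=> r; rewrite /p rmorphD mulrDl.
pose dp' (s : R) := complex.Re (u * (f' (s%:C * z) * z)).
have dpo s : s \in `]t, 1[ -> is_derive s 1 p (dp' s).
  by move=> /subset_itv_oo_cc; apply: dp.
have pc : {within `[t, 1], continuous p}.
  by apply: derivable_within_continuous => s /dp [].
have [s st pE] := MVT t1 dpo pc.
have <- : p 1 - p t = modulus (f z - f (t%:C * z)).
  by rewrite /p -raddfB -mulrBr mul1r uE.
rewrite pE /dp' ler_wpM2r ?subr_ge0 ?(ltW t1) //.
apply: le_trans (Re_le_modulus _) _.
rewrite !modulusM u1 mul1r ler_wpM2r ?modulus_ge0 // //.
by apply: f'M; apply: disc; apply: subset_itv_oo_cc st.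
Qed.

End RealDifferential.

(** * From almost everywhere to everywhere by continuity *)

Section AlmostEverywhere.
Context {R : realType}.
Local Notation C := (Cplx R).
Local Notation lebesgue2 := (@lebesgue_measure R \x @lebesgue_measure R)%E.

Lemma square_in_disc (z w : C) (d : R) : modulus z + 2 * d <= 1 ->
  `|complex.Re w - complex.Re z| < d -> `|complex.Im w - complex.Im z| < d ->
  unit_disc w.
Proof.
move=> zd wx wy; rewrite /unit_disc /= -(subrK z w).
apply: le_lt_trans (modulusD _ _) _.
have := modulus_le_ReDIm (w - z); rewrite !raddfB /=; lra.
Qed.

(** If u exceeded M at z, it would do so on a whole square around z; that square has positive
    measure yet lies in the exceptional null set. *)
Lemma ae_le_continuous (u : C -> R) (M : R) :
  (forall z, unit_disc z ->
     u w @[w --> within unit_disc (nbhs z)] --> u z) ->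
  {ae lebesgue2, forall p, unit_disc (reim p) -> u (reim p) <= M} ->
  forall z, unit_disc z -> u z <= M.
Proof.
move=> uc [N [mN N0 sub]] z z1; rewrite leNgt; apply/negP => Mu.
have /uc/(_ [set y | M < y]) := z1.
have /[swap]/[apply] : nbhs (u z) [set y | M < y] by apply: lt_nbhsr.
move=> /nbhs_ballP[e]; rewrite /= ltcE => /andP[/= /eqP ei e0] eP.
(* As |w| <= |Re w| + |Im w|, the first bound puts the square in the ball of radius e and the second
   keeps it in the disc. *)
pose d := Num.min (complex.Re e / 2) ((1 - modulus z) / 2).
have d0 : 0 < d by rewrite lt_min; apply/andP; split; move: z1; rewrite /unit_disc /=; lra.
have d1 : d <= complex.Re e / 2 by rewrite ge_min lexx.
have d2 : d <= (1 - modulus z) / 2 by rewrite ge_min lexx orbT.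
pose I (x : R) := `]x - d, x + d[%classic : set R.
have IN : I (complex.Re z) `*` I (complex.Im z) `<=` N.
  move=> [x y] [/=]; rewrite /I /= !in_itv /= => xd yd.
  have xd' : `|complex.Re (x +i* y) - complex.Re z| < d by rewrite /= ltr_norml; lra.
  have yd' : `|complex.Im (x +i* y) - complex.Im z| < d by rewrite /= ltr_norml; lra.
  have w1 : unit_disc (x +i* y : C) by apply: square_in_disc xd' yd'; lra.
  apply: sub => /= /(_ w1); rewrite leNgt => /negP; apply; apply: eP => //.
  rewrite /ball /= normr_modulus modulusB ltcE /= ei eqxx /=.
  apply: le_lt_trans (modulus_le_ReDIm _) _; rewrite !raddfB /=; lra.
have mI x : measurable (I x) by apply: measurable_itv.
have : (lebesgue2 (I (complex.Re z) `*` I (complex.Im z)) <= lebesgue2 N)%E.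
  by apply: le_measure => //; rewrite inE //; apply: measurableX; apply: mI.
have -> : lebesgue2 N = 0%E := N0.
have muI x : lebesgue_measure (I x) = (2 * d)%:E.
  rewrite lebesgue_measure_itv /= lte_fin ltrD2l gtrN // -EFinD.
  by congr (_%:E); ring.
have -> : lebesgue2 (I (complex.Re z) `*` I (complex.Im z)) =
    ((2 * d)%:E * (2 * d)%:E)%E.
  by rewrite product_measure1E; [congr (_ * _)%E; apply: muI | apply: mI..].
by rewrite -EFinM lee_fin leNgt !mulr_gt0.
Qed.

(** Both moduli are square roots of polynomials in the four real first partials, which are
    continuous because f is harmonic. *)
Lemma Lambda_continuous (O : set C) (f : C -> C) z : harmonic_on O f -> O z ->
  Lambda_ f w @[w --> within O (nbhs z)] --> Lambda_ f z.
Proof.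
move=> [[[_ _ ux uy] _ _ _] [[_ _ vx vy] _ _ _]] Oz.
move/subspace_continuousP: ux => /(_ z Oz) ux.
move/subspace_continuousP: uy => /(_ z Oz) uy.
move/subspace_continuousP: vx => /(_ z Oz) vx.
move/subspace_continuousP: vy => /(_ z Oz) vy.
(* The sign s = -1 gives f_z and s = 1 gives f_zbar. *)
have modE (a b c d : R) (s : R) :
    modulus (((a +i* b) + s%:C * ('i * (c +i* d))) / 2%:R : C) =
    Num.sqrt (((a - s * d) / 2) ^+ 2 + ((b + s * c) / 2) ^+ 2).
  rewrite (_ : _ / _ = ((a - s * d) / 2) +i* ((b + s * c) / 2) :> C) //.
  have two0 : (2%:R : C) != 0 by rewrite pnatr_eq0.
  apply: (mulIf two0); rewrite divfK // (_ : 2%:R = (2%:R : R)%:C) ?rmorph_nat //.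
  by apply/eqP; rewrite eq_complex /=; apply/andP; split; apply/eqP; field.
have LE w : Lambda_ f w =
   Num.sqrt (((du_dx (fun w => complex.Re (f w)) w
     - (-1) * du_dy (fun w => complex.Im (f w)) w) / 2) ^+ 2 +
    ((du_dx (fun w => complex.Im (f w)) w
     + (-1) * du_dy (fun w => complex.Re (f w)) w) / 2) ^+ 2)
   + Num.sqrt (((du_dx (fun w => complex.Re (f w)) w
     - 1 * du_dy (fun w => complex.Im (f w)) w) / 2) ^+ 2 +
    ((du_dx (fun w => complex.Im (f w)) w
     + 1 * du_dy (fun w => complex.Re (f w)) w) / 2) ^+ 2).
  rewrite -!modE /Lambda_ /d_dz /d_dzbar /d_dx /d_dy.
  by rewrite rmorphN1 mulN1r rmorph1 mul1r.
under eq_fun do rewrite LE; rewrite LE.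
have sqc (p q : C -> R) : p w @[w --> within O (nbhs z)] --> p z ->
    q w @[w --> within O (nbhs z)] --> q z ->
  Num.sqrt ((p w / 2) ^+ 2 + (q w / 2) ^+ 2) @[w --> within O (nbhs z)]
    --> Num.sqrt ((p z / 2) ^+ 2 + (q z / 2) ^+ 2).
  move=> pc qc; apply: continuous_cvg; first exact: sqrt_continuous.
  by rewrite !expr2; under eq_fun do rewrite !expr2;
    apply: cvgD; apply: cvgM; apply: cvgMl.
apply: cvgD; apply: sqc.
- by apply: cvgB; [exact: ux | apply: cvgM; [exact: cvg_cst | exact: vy]].
- by apply: cvgD; [exact: vx | apply: cvgM; [exact: cvg_cst | exact: uy]].
- by apply: cvgB; [exact: ux | apply: cvgM; [exact: cvg_cst | exact: vy]].
- by apply: cvgD; [exact: vx | apply: cvgM; [exact: cvg_cst | exact: uy]].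
Qed.

End AlmostEverywhere.

(** * Two real inequalities *)

Lemma elliptic_bound (R : realType) (A B K K' lam : R) :
  0 <= A -> 0 <= B -> 0 <= K -> 0 <= K' -> 0 < A ^+ 2 - B ^+ 2 ->
  (A + B) ^+ 2 <= K * (A ^+ 2 - B ^+ 2) + K' -> `|A - B| <= lam ->
  A + B <= K * lam + Num.sqrt K'.
Proof.
move=> A0 B0 K0 K'0 AB0 ellip ABlam; rewrite leNgt; apply/negP => lt_AB.
have s0 := sqrtr_ge0 K'; have s2 := sqr_sqrtr K'0.
set s := Num.sqrt K' in lt_AB s0 s2.
have lam0 : 0 <= lam by apply: le_trans ABlam.
have Klam0 : 0 <= K * lam by rewrite mulr_ge0.
have ABle : A - B <= lam by apply: le_trans ABlam; apply: ler_norm.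
have KAB : K * (A ^+ 2 - B ^+ 2) <= K * lam * (A + B).
  by rewrite subr_sqr mulrA ler_wpM2r ?addr_ge0 // ler_wpM2l.
(* With X = A + B and s^2 = K', X (X - K lam) <= s^2, whereas X > K lam + s makes X and X - K lam
   both exceed s >= 0. *)
nra.
Qed.

Lemma limit_power_bound (R : realType) (S M : R) (m : nat) :
  (forall r, 0 < r < 1 -> S * r ^+ m <= M) -> S <= M.
Proof.
move=> rM; rewrite leNgt; apply/negP => MS.
have Sc : S * r ^+ m @[r --> 1^'-] --> S.
  rewrite -[X in _ --> X]mulr1 -[X in _ * X](expr1n _ m).
  apply: cvgM; first exact: cvg_cst.
  by apply: cvg_at_left_filter; apply: exprn_continuous.
have : \forall r \near (1 : R)^'-, [/\ M < S * r ^+ m, 0 < r & r < 1].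
  near=> r; split; near: r.
  - by apply: (cvgr_gt _ Sc).
  - by apply: nbhs_left_gt.
  - by apply: nbhs_left_lt.
move=> /filter_ex[r [MSr r0 r1]].
by have := rM r; rewrite r0 r1 => /(_ isT); rewrite leNgt MSr.
Unshelve. all: by end_near.
Qed.

(** * The coefficient estimate *)

Theorem theorem2p1 (R : realType) (K K' : R) (f h g : Cplx R -> Cplx R)
    (a b : nat -> Cplx R) (lam : R)
    (hK : 1 <= K) (hK' : 0 <= K')
    (f_harmonic : harmonic_on unit_disc f)
    (f_elliptic : elliptic_on unit_disc K K' f)
    (h_analytic : analytic_on unit_disc h)
    (g_analytic : analytic_on unit_disc g)
    (f_decomp : forall z, unit_disc z -> f z = h z + conjc (g z))
    (h_series : forall z, unit_disc z ->
       (fun N : nat => \sum_(1 <= n < N.+1) a n * z ^+ n) @ \oo --> h z)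
    (g_series : forall z, unit_disc z ->
       (fun N : nat => \sum_(1 <= n < N.+1) b n * z ^+ n) @ \oo --> g z)
    (lam_bound : forall z, unit_disc z -> lambda_ f z <= lam) :
  forall n : nat, (1 <= n)%N ->
    modulus (a n) + modulus (b n) <= (K * lam + Num.sqrt K') / n%:R.
Proof.
move=> n n1.
set M := K * lam + Num.sqrt K'.
have [[f_sense _] _ _ f_ellip] := f_elliptic.
have LambdaM z : unit_disc z -> Lambda_ f z <= M.
  move: z; apply: ae_le_continuous.
    by move=> z z1; apply: Lambda_continuous.
  apply: filterS f_ellip => p pE p1.
  apply: elliptic_bound (pE p1) (lam_bound _ p1); rewrite ?modulus_ge0 //.
    exact: le_trans hK.
  exact: f_sense.
(* A derivative is chosen at each point; outside the disc the condition is vacuous. *)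
have /choice[h' h'E] : forall z, exists l, unit_disc z -> expands h z ( *%R l).
  move=> z; have [z1|] := pselect (unit_disc z); last by exists 0.
  by have [l lP] := derivable_expands (h_analytic z z1); exists l.
have /choice[g' g'E] : forall z, exists l, unit_disc z -> expands g z ( *%R l).
  move=> z; have [z1|] := pselect (unit_disc z); last by exists 0.
  by have [l lP] := derivable_expands (g_analytic z z1); exists l.
have [u u1 uE] := unimodular_rotation (a n).
have [v v1 vE] := unimodular_rotation (b n).
pose F z := u * h z + v * g z; pose F' z := u * h' z + v * g' z.
have FE z : unit_disc z -> expands F z ( *%R (F' z)).
  move=> z1; rewrite (_ : *%R (F' z) = fun w => u * (h' z * w) + v * (g' z * w)).
    by apply: expandsD; apply: expandsZ; [exact: h'E | exact: g'E].
  by apply/funext => w; rewrite /F' mulrDl !mulrA.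
have F'M z : unit_disc z -> modulus (F' z) <= M.
  move=> z1; apply: le_trans (modulusD _ _) _.
  rewrite !modulusM u1 v1 !mul1r; apply: le_trans (LambdaM z z1).
  have [fz fzbar] := harmonic_decomposition_derivatives z1 f_decomp (h'E z z1) (g'E z z1).
  by rewrite /Lambda_ fz fzbar modulus_conjc.
(* Read off at the origin; it gives M r <= M at the end. *)
have M0 : 0 <= M.
  have /F'M : unit_disc (0 : Cplx R).
    by change (is_true (modulus (0 : Cplx R) < 1)); rewrite modulus0 ltr01.
  by apply: le_trans; apply: modulus_ge0.
(* One factor r^n comes from Cauchy's estimate, the other from 1 + r + ... + r^(n-1) >= n r^n. *)
rewrite ler_pdivlMr ?ltr0n //; apply: (@limit_power_bound _ _ _ (n + n)) => r r01.
have [r0 r1] := andP r01.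
pose c k := (u * a k + v * b k) * (1 - r%:C ^+ k).
have cE : modulus (c n) = (modulus (a n) + modulus (b n)) * (1 - r ^+ n).
  rewrite modulusM uE vE -rmorphD modulus_real ger0_norm ?addr_ge0 ?modulus_ge0 //.
  rewrite (_ : 1 - r%:C ^+ n = (1 - r ^+ n)%:C); last by rewrite rmorphB rmorphXn rmorph1.
  by rewrite modulus_real ger0_norm // subr_ge0 exprn_ile1 // ltW.
have c_series z : unit_disc z -> (fun N => \sum_(1 <= k < N.+1) c k * z ^+ k) @ \oo
    --> F z - F (r%:C * z).
  move=> z1; have rz1 : unit_disc (r%:C * z).
    rewrite /unit_disc /= modulusM modulus_real gtr0_norm //.
    by apply: le_lt_trans z1; rewrite ler_piMl ?modulus_ge0 // ltW.
  have F_series w : unit_disc w ->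
      u * (\sum_(1 <= k < N.+1) a k * w ^+ k) + v * (\sum_(1 <= k < N.+1) b k * w ^+ k)
        @[N --> \oo] --> F w.
    by move=> w1; apply: cvgD; apply: cvgM;
      [exact: cvg_cst | exact: h_series | exact: cvg_cst | exact: g_series].
  apply: cvg_trans (cvgB (F_series z z1) (F_series _ rz1)).
  suff -> : (fun N => \sum_(1 <= k < N.+1) c k * z ^+ k) = (fun N : nat =>
      u * (\sum_(1 <= k < N.+1) a k * z ^+ k) + v * (\sum_(1 <= k < N.+1) b k * z ^+ k)
      - (u * (\sum_(1 <= k < N.+1) a k * (r%:C * z) ^+ k)
         + v * (\sum_(1 <= k < N.+1) b k * (r%:C * z) ^+ k))) by [].
  apply/funext => N.
  rewrite !big_distrr /= -!big_split /= -sumrB /=; apply: eq_bigr => k _.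
  by rewrite /c exprMn; ring.
(* On |z| = r the radial segment from rz to z has length r (1 - r). The factor 1 - r cancels against
   the one in 1 - r^n. *)
have : modulus (c n) * r ^+ n <= M * r * (1 - r).
  apply: (series_coef_bound r01 n1 c_series) => z zr.
  rewrite -[in M * r]zr; apply: (radial_increment_bound FE F'M).
    by rewrite ltW.
  by rewrite /unit_disc /= zr.
set S := modulus (a n) + modulus (b n) in cE *.
have S0 : 0 <= S by rewrite addr_ge0 ?modulus_ge0.
have powE : 1 - r ^+ n = (1 - r) * \sum_(i < n) r ^+ i.
  by rewrite -opprB subrX1 -mulNr opprB.
rewrite cE powE (_ : S * _ * _ = S * ((\sum_(i < n) r ^+ i) * r ^+ n) * (1 - r)); last by ring.
rewrite ler_pM2r ?subr_gt0 // => Sle.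
apply: le_trans (_ : M * r <= M); last by rewrite ler_piMr // ltW.
apply: le_trans Sle; rewrite -mulrA ler_wpM2l // exprD mulrA ler_wpM2r ?exprn_ge0 ?(ltW r0) //.
rewrite mulr_natl -[n in _ *+ n]card_ord -sumr_const ler_sum // => i _.
by rewrite ler_wiXn2l ?(ltW r0) ?(ltW r1) // ltnW.
Qed.
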